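(* Let $\mathfrak c$ be an elementary type construction over $\mathfrak B$ and let $\mathcal A=(Z_1,\dots,Z_r)$ be a principal tuple in $\mathcal G(\mathfrak c)$. Then every $\mathcal A$-automorphism $\alpha$ of $Z_1\times\cdots\times Z_r$ extends to an automorphism of the cyclotomic pro-$p$ pair $\mathcal G(\mathfrak c)$.
   Context: Fix a prime $p$. A cyclotomic pro-$p$ pair $(G,\theta)$ is a pro-$p$ group $G$ with a continuous homomorphism $\theta\colon G\to1+p\mathbb Z_p$; a morphism $(G_1,\theta_1)\to(G_2,\theta_2)$ is a continuous homomorphism $\phi$ with $\theta_1=\theta_2\circ\phi$ (an automorphism is a bijective morphism of a pair to itself). Free product: $(G_1,\theta_1)*(G_2,\theta_2)=(G_1*_pG_2,\theta)$ with $G_1*_pG_2$ the free pro-$p$ product and $\theta$ the unique extension of $\theta_1,\theta_2$. Extension: for $Z\cong\mathbb Z_p$ (multiplicative) and a pair $(\bar G,\bar\theta)$, $Z\rtimes(\bar G,\bar\theta)=(Z\rtimes\bar G,\bar\theta\circ\pi)$ where $\bar gz\bar g^{-1}=z^{\bar\theta(\bar g)}$ and $\pi$ is the projection to $\bar G$. Fix a nonempty class $\mathfrak B$ of pairs. Elementary type constructions $\mathfrak c$ over $\mathfrak B$ (formal expressions) and their pairs $\mathcal G(\mathfrak c)$ are defined inductively: (i) each $\mathcal B\in\mathfrak B$ is one, with $\mathcal G(\mathcal B)=\mathcal B$; (ii) if $\mathfrak c_1,\mathfrak c_2$ are constructions, neither being the trivial pair $(1,1)$, then $\mathfrak c_1\diamond\mathfrak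 c_2$ is one, with $\mathcal G(\mathfrak c_1\diamond\mathfrak c_2)=\mathcal G(\mathfrak c_1)*\mathcal G(\mathfrak c_2)$; (iii) if $\bar{\mathfrak c}$ is one then so is $\langle\bar{\mathfrak c}\rangle$, with $\mathcal G(\langle\bar{\mathfrak c}\rangle)=Z\rtimes\mathcal G(\bar{\mathfrak c})$, $Z\cong\mathbb Z_p$. Principal tuples of $\mathcal G(\mathfrak c)$ are finite sequences of closed subgroups of the underlying group, defined inductively: (i) for $\mathfrak c=\mathcal B\in\mathfrak B$ the only one is the empty tuple; (ii) for $\mathfrak c_1\diamond\mathfrak c_2$ they are the principal tuples of $\mathcal G(\mathfrak c_1)$ or of $\mathcal G(\mathfrak c_2)$, viewed inside the free product; (iii) for $\langle\bar{\mathfrak c}\rangle$ with $\mathcal G=Z\rtimes\mathcal G(\bar{\mathfrak c})$ they are the tuples $(Z_1,\dots,Z_r,Z)$ with $(Z_1,\dots,Z_r)$ a principal tuple of $\mathcal G(\bar{\mathfrak c})$ (viewed inside $Z\rtimes G(\bar{\mathfrak c})$). For a principal tuple $(Z_1,\dots,Z_r)$, each $Z_i\cong\mathbb Z_p$ and $Z_1\times\cdots\times Z_r$ is a closed free abelian subgroup of rank $r$. For such a tuple $\mathcal A$, put $V^j\mathcal A=Z_{j+1}\times\cdots\times Z_r$ ($0\le j\le r$); an $\mathcal A$-automorphism is an automorphism $\alpha$ of $Z_1\times\cdots\times Z_r$ with $\alpha(V^j\mathcal A)=V^j\mathcal A$ for all $1\le j\le r$. *)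

(* Defs.v *)
From HB Require Import structures.
From mathcomp Require Import all_boot all_order all_algebra all_fingroup.
From mathcomp Require Import pgroup cyclic.
From mathcomp Require Import boolp classical_sets functions cardinality filter.
From mathcomp Require Import topology.

Set Implicit Arguments.
Unset Strict Implicit.
Unset Printing Implicit Defensive.

Import GRing.Theory.
Local Open Scope classical_set_scope.
Local Open Scope ring_scope.

(* The ring Z_p of p-adic integers, as the inverse limit of the rings         *)
(* Z/p^(n+1); the exponents start at 1 because 'Z_1 is not the zero ring. The *)
(* argument p_pr is used only by the instances: compatible sequences form a   *)
(* ring as soon as p > 1.                                                     *)
Record padic (p : nat) (p_pr : prime p) := Padic {
  padic_val :> forall n, 'Z_(p ^ n.+1);
  padic_compat :
    forall n, ((padic_val n.+1 : nat) = padic_val n %[mod p ^ n.+1])%N }.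

Section PadicRing.
Variables (p : nat) (p_pr : prime p).
Local Notation Zp := (padic p_pr).

Lemma padicP (x y : Zp) : (forall n, x n = y n) -> x = y.
Proof.
case: x y => [x xP] [y yP] /= xy.
have {}xy : x = y by exact: functional_extensionality_dep.
by rewrite xy in xP *; congr Padic; exact: Prop_irrelevance.
Qed.

HB.instance Definition _ := gen_eqMixin Zp.
HB.instance Definition _ := gen_choiceMixin Zp.

Lemma pexp_gt1 n : (1 < p ^ n.+1)%N.
Proof. by rewrite -{1}(exp1n n.+1) ltn_exp2r// prime_gt1. Qed.

Lemma pexp_trunc n : (Zp_trunc (p ^ n.+1)).+2 = (p ^ n.+1)%N.
Proof. by rewrite Zp_cast// pexp_gt1. Qed.

Lemma val_padicD n (a b : 'Z_(p ^ n.+1)) :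
  nat_of_ord (a + b) = ((a + b) %% p ^ n.+1)%N.
Proof. by rewrite /=; congr (_ %% _)%N; exact: pexp_trunc. Qed.

Lemma val_padicM n (a b : 'Z_(p ^ n.+1)) :
  nat_of_ord (a * b) = ((a * b) %% p ^ n.+1)%N.
Proof. by rewrite /=; congr (_ %% _)%N; exact: pexp_trunc. Qed.

Lemma padic_dvd n : (p ^ n.+1 %| p ^ n.+2)%N.
Proof. exact: dvdn_exp2l. Qed.

Lemma padic0_compat n :
  (nat_of_ord (0%R : 'Z_(p ^ n.+2)) = (0%R : 'Z_(p ^ n.+1)) %[mod p ^ n.+1])%N.
Proof. by []. Qed.

Lemma padic1_compat n :
  (nat_of_ord (1%R : 'Z_(p ^ n.+2)) = (1%R : 'Z_(p ^ n.+1)) %[mod p ^ n.+1])%N.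
Proof. by []. Qed.

Lemma padicD_compat (x y : Zp) n :
  (nat_of_ord (x n.+1 + y n.+1)%R = (x n + y n)%R %[mod p ^ n.+1])%N.
Proof.
rewrite !val_padicD modn_dvdm ?padic_dvd// modn_mod.
by rewrite -modnDm !padic_compat modnDm.
Qed.

Lemma padicM_compat (x y : Zp) n :
  (nat_of_ord (x n.+1 * y n.+1)%R = (x n * y n)%R %[mod p ^ n.+1])%N.
Proof.
rewrite !val_padicM modn_dvdm ?padic_dvd// modn_mod.
by rewrite -modnMm !padic_compat modnMm.
Qed.

Lemma padicN_compat (x : Zp) n :
  (nat_of_ord (- x n.+1)%R = (- x n)%R %[mod p ^ n.+1])%N.
Proof.
have opp_dvd k (a : 'Z_(p ^ k.+1)) : (p ^ k.+1 %| (- a)%R + a)%N.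
  by rewrite /dvdn -val_padicD addNr.
apply/eqP; rewrite -(eqn_modDr (x n)) -modnDmr -padic_compat modnDmr.
have /eqP -> := dvdn_trans (padic_dvd n) (opp_dvd _ (x n.+1)).
by rewrite eq_sym; exact: opp_dvd.
Qed.

Definition padic_zero : Zp := Padic p_pr padic0_compat.
Definition padic_one : Zp := Padic p_pr padic1_compat.
Definition padic_add (x y : Zp) : Zp := Padic p_pr (padicD_compat x y).
Definition padic_mul (x y : Zp) : Zp := Padic p_pr (padicM_compat x y).
Definition padic_opp (x : Zp) : Zp := Padic p_pr (padicN_compat x).

Fact padic_addA : associative padic_add.
Proof. by move=> x y z; apply: padicP => n; exact: addrA. Qed.
Fact padic_addC : commutative padic_add.
Proof. by move=> x y; apply: padicP => n; exact: addrC. Qed.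
Fact padic_add0 : left_id padic_zero padic_add.
Proof. by move=> x; apply: padicP => n; exact: add0r. Qed.
Fact padic_addN : left_inverse padic_zero padic_opp padic_add.
Proof. by move=> x; apply: padicP => n; exact: addNr. Qed.

HB.instance Definition _ := GRing.isZmodule.Build Zp
  padic_addA padic_addC padic_add0 padic_addN.

Fact padic_mulA : associative padic_mul.
Proof. by move=> x y z; apply: padicP => n; exact: mulrA. Qed.
Fact padic_mulC : commutative padic_mul.
Proof. by move=> x y; apply: padicP => n; exact: mulrC. Qed.
Fact padic_mul1 : left_id padic_one padic_mul.
Proof. by move=> x; apply: padicP => n; exact: mul1r. Qed.
Fact padic_mulD : left_distributive padic_mul padic_add.
Proof. by move=> x y z; apply: padicP => n; exact: mulrDl. Qed.
Fact padic_1neq0 : padic_one != 0.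
Proof.
apply/eqP => /(congr1 (fun x : Zp => x 0%N)) /eqP.
by rewrite /= -[_ == _]/(1 == 0 :> 'Z_(p ^ 1)) oner_eq0.
Qed.

HB.instance Definition _ := GRing.Zmodule_isComNzRing.Build Zp
  padic_mulA padic_mulC padic_mul1 padic_mulD padic_1neq0.

End PadicRing.

(* The p-adic topology: the cosets x + p^(n+1) Z_p form a neighbourhood base  *)
(* at x.                                                                      *)
Section PadicTopology.
Variables (p : nat) (p_pr : prime p).
Local Notation Zp := (padic p_pr).

Definition padic_nbhs (x : Zp) : set_system Zp :=
  [set U | exists n, [set y : Zp | y n = x n] `<=` U].

HB.instance Definition _ := hasNbhs.Build Zp padic_nbhs.

Lemma padic_eq_le (x y : Zp) m n : (m <= n)%N -> x n = y n -> x m = y m.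
Proof.
elim: n => [|n IHn]; first by rewrite leqn0 => /eqP ->.
rewrite leq_eqVlt ltnS => /orP[/eqP -> //|le_mn] xy; apply: IHn => //.
apply: val_inj => /=.
have lt (z : Zp) : (z n < p ^ n.+1)%N by rewrite -[X in (_ < X)%N]pexp_trunc.
rewrite -[LHS](modn_small (lt x)) -[RHS](modn_small (lt y)).
by rewrite -!padic_compat xy.
Qed.

Fact padic_nbhs_filter (x : Zp) : ProperFilter (nbhs x).
Proof.
split; first by case=> n /(_ x); exact.
split; first by exists 0%N.
- move=> U V [m xU] [n xV]; exists (maxn m n) => y yx; split.
  + by apply: xU; exact: padic_eq_le (leq_maxl _ _) yx.
  + by apply: xV; exact: padic_eq_le (leq_maxr _ _) yx.
- by move=> U V UV [n xU]; exists n; exact: subset_trans UV.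
Qed.

Fact padic_nbhs_singleton (x : Zp) (U : set Zp) : nbhs x U -> U x.
Proof. by case=> n; exact. Qed.

Fact padic_nbhs_nbhs (x : Zp) (U : set Zp) : nbhs x U -> nbhs x (nbhs^~ U).
Proof.
by case=> n xU; exists n => y yx; exists n => z zy; apply: xU; rewrite /= zy.
Qed.

HB.instance Definition _ := Nbhs_isNbhsTopological.Build Zp
  padic_nbhs_filter padic_nbhs_singleton padic_nbhs_nbhs.

Lemma padic_addrS (x y x' y' : Zp) n :
  x n = x' n -> y n = y' n -> (x + y) n = (x' + y') n.
Proof. by move=> xx yy; rewrite -[LHS]/(x n + y n) xx yy. Qed.

Lemma padic_mulrS (x y x' y' : Zp) n :
  x n = x' n -> y n = y' n -> (x * y) n = (x' * y') n.
Proof. by move=> xx yy; rewrite -[LHS]/(x n * y n) xx yy. Qed.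

Lemma padic_add_continuous : continuous (fun x : Zp * Zp => x.1 + x.2).
Proof.
move=> [x y] U [n xyU].
exists ([set z : Zp | z n = x n], [set z : Zp | z n = y n]).
  by split; exists n.
by move=> z [/= zx zy]; apply: xyU; exact: padic_addrS.
Qed.

Lemma padic_mul_continuous : continuous (fun x : Zp * Zp => x.1 * x.2).
Proof.
move=> [x y] U [n xyU].
exists ([set z : Zp | z n = x n], [set z : Zp | z n = y n]).
  by split; exists n.
by move=> z [/= zx zy]; apply: xyU; exact: padic_mulrS.
Qed.

Lemma padic_opp_continuous : continuous (fun x : Zp => - x).
Proof.
move=> x U [n xU]; exists n => y yx; apply: xU => /=.
by rewrite -[LHS]/(- y n) yx.
Qed.

Lemma padic_zero_dimensional : zero_dimensional Zp.
Proof.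
move=> x y xy; have [n xyn] : exists n, x n != y n.
  apply: contrapT => xyE; move/eqP: xy; apply; apply: padicP => n.
  by apply/eqP; apply: contrapT => /negP xyn; apply: xyE; exists n.
exists [set z : Zp | z n = x n]; split => //=; last first.
  by move=> yx; rewrite yx eqxx in xyn.
split; first by rewrite openE => z zx; exists n => t /= ->.
by rewrite -openC openE => z zx; exists n => t /= ->.
Qed.

Lemma padic_hausdorff : hausdorff_space Zp.
Proof.
move=> x y xy; apply: padicP => n.
have [||z [<- <-] //] := xy [set z | z n = x n] [set z | z n = y n].
  by exists n.
by exists n.
Qed.

Lemma padic_compact : compact [set: Zp].
Proof.
rewrite compact_ultra => F FU _.
have Fn n : exists c : 'Z_(p ^ n.+1), F [set x : Zp | x n = c].
  apply: contrapT => nF.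
  have Fall : F [set x : Zp | forall c, x n <> c].
    apply: filter_forall => c.
    have [Fc|//] := in_ultra_setVsetC [set x : Zp | x n = c] FU.
    by case: nF; exists c.
  by have [x /(_ (x n))] := filter_ex Fall.
pose c n := projT1 (cid (Fn n)).
have Fc n : F [set x : Zp | x n = c n] by rewrite /c; case: cid.
have c_compat n : (nat_of_ord (c n.+1) = c n %[mod p ^ n.+1])%N.
  have [x [/= <- <-]] := filter_ex (filterI (Fc n.+1) (Fc n)).
  exact: padic_compat.
exists (Padic p_pr c_compat); split=> // U [n cU].
by apply: filterS (Fc n).
Qed.

End PadicTopology.

Section ContinuousOperations.
Variables T U V : topologicalType.

Lemma cts_fst : continuous (@fst T U).
Proof. by move=> x; exact: cvg_fst. Qed.

Lemma cts_snd : continuous (@snd T U).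
Proof. by move=> x; exact: cvg_snd. Qed.

Lemma cts_comp (f : T -> U) (g : U -> V) :
  continuous f -> continuous g -> continuous (fun x => g (f x)).
Proof. by move=> fC gC x; exact: (continuous_comp (fC x) (gC _)). Qed.

Lemma cts_pair (f : T -> U) (g : T -> V) :
  continuous f -> continuous g -> continuous (fun x => (f x, g x)).
Proof. by move=> fC gC x; exact: cvg_pair (fC x) (gC x). Qed.

End ContinuousOperations.

Lemma cts_op2 (T U V W : topologicalType) (f : T -> U) (g : T -> V)
    (op : U * V -> W) :
  continuous f -> continuous g -> continuous op ->
  continuous (fun x => op (f x, g x)).
Proof. by move=> fC gC; apply: cts_comp; exact: cts_pair. Qed.

HB.mixin Record isTopGroup G of monoid.Group G & Topological G := {
  mulg_continuous : continuous (fun x : G * G => (x.1 * x.2)%g);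
  invg_continuous : continuous (fun x : G => (x^-1)%g) }.

#[short(type="topGroupType")]
HB.structure Definition TopGroup :=
  {G of monoid.Group G & Topological G & isTopGroup G}.

(* A pro-p group is a profinite group all of whose finite continuous          *)
(* quotients are p-groups.                                                    *)
HB.mixin Record isProP (p : nat) G of TopGroup G := {
  proP_compact : compact [set: G];
  proP_hausdorff : hausdorff_space G;
  proP_disconnected : totally_disconnected [set: G];
  proP_quotient : forall (H : finGroupType) (f : G -> H),
    monoid.monoid_morphism f -> continuous (f : G -> discrete_topology H) ->
    set_surj [set: G] [set: H] f -> (p.-group [set: H]%SET)%g }.

#[short(type="proPGroupType")]
HB.structure Definition ProP (p : nat) := {G of TopGroup G & isProP p G}.

Section CyclotomicPairs.
Variables (p : nat) (p_pr : prime p).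
Local Notation Zp := (padic p_pr).

Lemma padic_mulrn_pexp n (z : Zp) : (z *+ (p ^ n.+1)) n = 0.
Proof.
have natE k : (z *+ k) n = z n *+ k.
  by elim: k => [//|k IHk]; rewrite !mulrS -IHk.
rewrite natE -mulr_natr -[RHS](mulr0 (z n)); congr (_ * _).
exact: pchar_Zp (pexp_gt1 p_pr n).
Qed.

Record cyclotomic_pair := CyclotomicPair {
  pair_group :> proPGroupType p;
  cyclo : pair_group -> Zp;
  cyclo1 : cyclo 1%g = 1;
  cycloM : {morph cyclo : g h / (g * h)%g >-> g * h};
  cyclo_continuous : continuous cyclo;
  cyclo_principal : forall g, exists y : Zp, cyclo g = 1 + p%:R * y }.

Definition cont_morphism (G H : topGroupType) (f : G -> H) : Prop :=
  monoid.monoid_morphism f /\ continuous f.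

Definition pair_morphism (P Q : cyclotomic_pair) (f : P -> Q) : Prop :=
  cont_morphism f /\ forall g, cyclo (f g) = cyclo g.

Definition pair_automorphism (P : cyclotomic_pair) (f : P -> P) : Prop :=
  pair_morphism f /\ bijective f.

Definition trivial_pair (P : cyclotomic_pair) : Prop := forall g : P, g = 1%g.

(* G, with the canonical maps i1 and i2, is the free pro-p product of G1 and  *)
(* G2: it is the coproduct in the category of pro-p groups.                   *)
Definition free_proP_product (G1 G2 G : proPGroupType p)
    (i1 : G1 -> G) (i2 : G2 -> G) : Prop :=
  [/\ cont_morphism i1, cont_morphism i2 &
    forall (K : proPGroupType p) (f1 : G1 -> K) (f2 : G2 -> K),
      cont_morphism f1 -> cont_morphism f2 ->
      exists! f : G -> K,
        [/\ cont_morphism f, f \o i1 = f1 & f \o i2 = f2]].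

Definition free_pair_product (P1 P2 P : cyclotomic_pair)
    (i1 : P1 -> P) (i2 : P2 -> P) : Prop :=
  [/\ free_proP_product i1 i2,
      forall g, cyclo (i1 g) = cyclo g & forall g, cyclo (i2 g) = cyclo g].

Section Extension.
Variable P : cyclotomic_pair.

(* The underlying group of Z ><| P, with Z = Z_p written additively: (z, g)   *)
(* stands for z g, and g acts on Z as multiplication by its cyclotomic value. *)
Definition ext_group : Type := (Zp * P)%type.

HB.instance Definition _ := Topological.copy ext_group (Zp * P)%type.

Definition ext_one : ext_group := (0, 1%g).
Definition ext_mul (x y : ext_group) : ext_group :=
  (x.1 + cyclo x.2 * y.1, (x.2 * y.2)%g).
Definition ext_inv (x : ext_group) : ext_group :=
  (- (cyclo x.2^-1%g * x.1), x.2^-1%g).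

Fact ext_mulA : associative ext_mul.
Proof.
move=> [a g] [b h] [c k]; rewrite /ext_mul /= mulgA cycloM.
by rewrite mulrDr mulrA addrA.
Qed.
Fact ext_mul1 : left_id ext_one ext_mul.
Proof. by move=> [a g]; rewrite /ext_mul /= cyclo1 mul1r add0r mul1g. Qed.
Fact ext_mulr1 : right_id ext_one ext_mul.
Proof. by move=> [a g]; rewrite /ext_mul /= mulr0 addr0 mulg1. Qed.
Fact ext_mulV : left_inverse ext_one ext_inv ext_mul.
Proof. by move=> [a g]; rewrite /ext_mul /= addNr mulVg. Qed.
Fact ext_mulrV : right_inverse ext_one ext_inv ext_mul.
Proof.
move=> [a g]; rewrite /ext_mul /= mulrN mulrA -cycloM mulgV cyclo1.
by rewrite mul1r subrr.
Qed.

HB.instance Definition _ := isGroup.Build ext_group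
  ext_mulA ext_mul1 ext_mulr1 ext_mulV ext_mulrV.

Fact ext_mul_continuous :
  continuous (fun x : ext_group * ext_group => (x.1 * x.2)%g).
Proof.
have ctsc : continuous (fun x : ext_group * ext_group => cyclo x.1.2).
  apply: cts_comp (@cyclo_continuous P).
  exact: cts_comp (@cts_fst _ _) (@cts_snd _ _).
apply: (@cts_pair _ Zp P); last first.
  apply: cts_op2 (@mulg_continuous P).
    exact: cts_comp (@cts_fst _ _) (@cts_snd _ _).
  exact: cts_comp (@cts_snd _ _) (@cts_snd _ _).
apply: cts_op2 (@padic_add_continuous p p_pr).
  exact: cts_comp (@cts_fst _ _) (@cts_fst _ _).
apply: cts_op2 ctsc _ (@padic_mul_continuous p p_pr).
exact: cts_comp (@cts_snd _ _) (@cts_fst _ _).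
Qed.

Fact ext_inv_continuous : continuous (fun x : ext_group => (x^-1)%g).
Proof.
have ctsV : continuous (fun x : ext_group => (x.2^-1)%g : P).
  exact: cts_comp (@cts_snd _ _) (@invg_continuous P).
apply: (@cts_pair _ Zp P) => //.
apply: cts_comp (@padic_opp_continuous p p_pr).
apply: cts_op2 (@cts_fst _ _) (@padic_mul_continuous p p_pr).
exact: cts_comp ctsV (@cyclo_continuous P).
Qed.

HB.instance Definition _ := isTopGroup.Build ext_group
  ext_mul_continuous ext_inv_continuous.

Fact ext_compact : compact [set: ext_group].
Proof.
rewrite -setXTT.
exact: compact_setX (@padic_compact p p_pr) (@proP_compact p P).
Qed.

Fact ext_hausdorff : hausdorff_space ext_group.
Proof.
move=> [a g] [b h] ab; congr (_, _).
  apply: padic_hausdorff => U V Ua Vb.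
  have [||[z k] [/= [Uz _] [Vz _]]] := ab (U `*` setT) (V `*` setT).
  - by exists (U, setT) => //; split=> //=; exact: filterT.
  - by exists (V, setT) => //; split=> //=; exact: filterT.
  - by exists z.
apply: (@proP_hausdorff p P) => U V Ug Vh.
have [||[z k] [/= [_ Uz] [_ Vz]]] := ab (setT `*` U) (setT `*` V).
- by exists (setT, U) => //; split=> //=; exact: filterT.
- by exists (setT, V) => //; split=> //=; exact: filterT.
- by exists k.
Qed.

Fact ext_disconnected : totally_disconnected [set: ext_group].
Proof.
move=> x _; apply/seteqP; split=> [y|_ ->]; last first.
  exact: connected_component_refl.
move=> [C [Cx _ Cconn] Cy].
have y1 : y.1 = x.1.
  have zd := zero_dimension_totally_disconnected (@padic_zero_dimensional p p_pr).
  suff : connected_component setT x.1 y.1 by rewrite zd.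
  exists (fst @` C); last by exists y.
  split; [by exists x|by []|].
  apply: (connected_continuous_connected Cconn).
    apply: continuous_subspaceT; exact: cts_fst.
have y2 : y.2 = x.2.
  suff : connected_component setT x.2 y.2 by rewrite (@proP_disconnected p P).
  exists (snd @` C); last by exists y.
  split; [by exists x|by []|].
  apply: (connected_continuous_connected Cconn).
    apply: continuous_subspaceT; exact: cts_snd.
by case: x y y1 y2 {Cx Cy} => [a g] [b h] /= -> ->.
Qed.

Fact ext_quotient (H : finGroupType) (f : ext_group -> H) :
  monoid.monoid_morphism f -> continuous (f : ext_group -> discrete_topology H) ->
  set_surj [set: ext_group] [set: H] f -> (p.-group [set: H]%SET)%g.
Proof.
move=> [f1 fM] fC fsurj.
pose fz (z : Zp) := f ((z, 1%g) : ext_group).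
pose fg (g : P) := f ((0, g) : ext_group).
have fzg z g : f (z, g) = (fz z * fg g)%g.
  by rewrite -fM; congr f; rewrite /mul /= /ext_mul /= mulr0 addr0 mul1g.
have fzD : {morph fz : a b / a + b >-> (a * b)%g}.
  by move=> a b; rewrite -fM /mul /= /ext_mul /= cyclo1 mul1r mulg1.
have fgM : {morph fg : a b / (a * b)%g}.
  by move=> a b; rewrite -fM /mul /= /ext_mul /= mulr0 addr0.
have fsurjE h : exists x, f x = h by have [//|x _ <-] := fsurj h; exists x.
pose K := [set h | `[< exists z, fz z = h >]]%SET.
have KP h : reflect (exists z, fz z = h) (h \in K).
  by rewrite inE; exact: asboolP.
have Kgroup : group_set K.
  apply/group_setP; split; first by apply/KP; exists 0; exact: f1.
  move=> _ _ /KP[a <-] /KP[b <-].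
  by apply/KP; exists (a + b).
have fzX z k : (fz z ^+ k)%g = fz (z *+ k).
  elim: k => [|k IHk]; first by rewrite expg0 mulr0n -f1.
  by rewrite expgS mulrS fzD IHk.
pose KG := group Kgroup.
have pK : (p.-group KG)%g.
  apply/pgroupP => q q_pr qK.
  have [h hK hq] := Cauchy q_pr qK.
  move: hK => /KP[z zh].
  have [n nker] : exists n, forall y : Zp, y n = 0 -> fz y = 1%g.
    have /fC : nbhs (f 1%g : discrete_topology H) [set 1%g].
      by rewrite f1; exact: discrete_set1.
    case=> -[A B] /= [[n An] B1] AB; exists n => y yn.
    by apply: (AB (y, 1%g)); split => /=; [exact: An|exact: nbhs_singleton B1].
  have : (#[h]%g %| p ^ n.+1)%N.
    by rewrite order_dvdn -zh fzX nker ?eqxx// padic_mulrn_pexp.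
  by rewrite hq Euclid_dvdX// dvdn_prime2// => /andP[].
have nK : [set: H]%SET \subset 'N(KG)%g.
  apply/fintype.subsetP => h _; have [[w g] <-] := fsurjE h.
  apply/normP/eqP; rewrite eqEcard cardJg leqnn andbT.
  apply/fintype.subsetP => _ /imsetP[k /KP[z <-] ->].
  apply/KP; exists (cyclo g^-1%g * z); rewrite conjgE.
  apply: (mulgI (f (w, g))); rewrite mulgA mulgV mul1g -!fM.
  congr f; rewrite /mul /= /ext_mul /= mulg1 mul1g mulrA -cycloM mulgV.
  by rewrite cyclo1 !mul1r addrC.
rewrite -(pquotient_pgroup pK nK).
have -> : ([set: H]%SET / KG)%g = [set: coset_of KG]%SET.
  exact: quotientT.
apply: (@proP_quotient p P _ (fun g => coset KG (fg g))).
- split; first by rewrite -[fg 1%g]/(f 1%g) f1 morph1.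
  by move=> g h; rewrite fgM morphM ?(fintype.subsetP nK) ?inE.
- apply: (@cts_comp _ (discrete_topology H) (discrete_topology (coset_of KG))
    fg (coset KG)); last first.
    by move=> h U /nbhs_singleton Uh; apply: filterS (discrete_set1 _) => _ ->.
  apply: (@cts_comp _ ext_group (discrete_topology H)) fC.
  by apply: (@cts_pair _ Zp P) => ?; [exact: cvg_cst|exact: cvg_id].
- move=> C _; have [h _ ->] := cosetP C; have [[z g] <-] := fsurjE h.
  have zK : fz z \in KG by apply/KP; exists z.
  exists g => //=; rewrite fzg -[LHS]mul1g -(coset_id zK).
  by rewrite morphM ?(fintype.subsetP nK) ?inE.
Qed.

HB.instance Definition _ := isProP.Build p ext_group
  ext_compact ext_hausdorff ext_disconnected ext_quotient.

Definition ext_cyclo (x : ext_group) : Zp := cyclo x.2.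

Fact ext_cyclo1 : ext_cyclo 1%g = 1.
Proof. exact: cyclo1. Qed.
Fact ext_cycloM : {morph ext_cyclo : x y / (x * y)%g >-> x * y}.
Proof. by move=> x y; exact: cycloM. Qed.
Fact ext_cyclo_continuous : continuous ext_cyclo.
Proof. exact: cts_comp (@cts_snd _ _) (@cyclo_continuous P). Qed.
Fact ext_cyclo_principal (x : ext_group) :
  exists y : Zp, ext_cyclo x = 1 + p%:R * y.
Proof. exact: cyclo_principal. Qed.

Definition ext_pair : cyclotomic_pair :=
  CyclotomicPair ext_cyclo1 ext_cycloM ext_cyclo_continuous ext_cyclo_principal.

Definition ext_incl (g : P) : ext_pair := ((0, g) : ext_group).

Definition ext_kernel : set ext_pair := [set x : ext_group | x.2 = 1%g].

End Extension.

(* [et_construction B P] is the type of the elementary type constructions c   *)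
(* over B such that G(c) = P. A free product is unique only up to a unique    *)
(* isomorphism, so an ETFree node records a model P of it together with its   *)
(* canonical maps. Free products of nontrivial pairs and all extensions are   *)
(* nontrivial, so asking that G(c1) and G(c2) be nontrivial only excludes     *)
(* that c1 or c2 is a trivial pair of B.                                      *)
Inductive et_construction (B : cyclotomic_pair -> Prop) :
  cyclotomic_pair -> Type :=
| ETBase (P : cyclotomic_pair) : B P -> et_construction B P
| ETFree (P1 P2 P : cyclotomic_pair) (i1 : P1 -> P) (i2 : P2 -> P) :
    et_construction B P1 -> et_construction B P2 ->
    ~ trivial_pair P1 -> ~ trivial_pair P2 -> free_pair_product i1 i2 ->
    et_construction B P
| ETExt (P : cyclotomic_pair) :
    et_construction B P -> et_construction B (ext_pair P).

Definition image_tuple (G H : Type) (f : G -> H) (A : seq (set G)) :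
  seq (set H) := [seq f @` Z | Z <- A].

Fixpoint principal_tuple (B : cyclotomic_pair -> Prop) (P : cyclotomic_pair)
    (c : et_construction B P) : set (seq (set P)) :=
  match c in et_construction _ P return set (seq (set P)) with
  | ETBase _ _ => [set [::]]
  | ETFree _ _ _ i1 i2 c1 c2 _ _ _ =>
      image_tuple i1 @` principal_tuple c1 `|`
      image_tuple i2 @` principal_tuple c2
  | ETExt P c =>
      [set rcons (image_tuple (@ext_incl P) A) (@ext_kernel P) |
         A in principal_tuple c]
  end.

(* Z_1 x ... x Z_r as a subset of the ambient group                           *)
Definition tuple_product (G : groupType) (A : seq (set G)) : set G :=
  foldr (fun X Y : set G => [set (x * y)%g | x in X & y in Y]) [set 1%g] A.

(* V^j A is [tuple_product (drop j A)]. An A-automorphism is given by any     *)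
(* function on the ambient group; only its values on Z_1 x ... x Z_r matter.  *)
Definition tuple_automorphism (G : topGroupType) (A : seq (set G))
    (alpha : G -> G) : Prop :=
  [/\ {within tuple_product A, continuous alpha},
      {in tuple_product A &, {morph alpha : x y / (x * y)%g}},
      set_bij (tuple_product A) (tuple_product A) alpha &
      forall j, (1 <= j <= size A)%N ->
        alpha @` tuple_product (drop j A) = tuple_product (drop j A)].

End CyclotomicPairs.

(* Main.v *)
From HB Require Import structures.
From mathcomp Require Import all_boot all_order all_algebra all_fingroup.
From mathcomp Require Import pgroup.
From mathcomp Require Import boolp classical_sets functions cardinality filter.
From mathcomp Require Import topology.
Require Import Defs.

(* Induction on the construction. In a free product the tuple lives in one    *)
(* factor; extend there and glue with the identity of the other factor. The   *)
(* glued map preserves the cyclotomic character because modulo p^n two        *)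
(* characters that agree on both factors have a quotient with finite p-group  *)
(* image. In an extension Z ><| G, alpha acts on Z as multiplication by a     *)
(* unit u of Z_p, induces an automorphism of the tuple of G, which extends to *)
(* some sigma by induction, and sends (0, x) to (delta x, sigma x) with delta *)
(* additive, because the cyclotomic character is trivial on principal tuples. *)
(* A second induction extends delta to a crossed homomorphism d : G -> Z_p,   *)
(* and (z, g) |-> (u z + d g, sigma g) is the required automorphism.          *)

Set Implicit Arguments.
Unset Strict Implicit.
Unset Printing Implicit Defensive.

Import GRing.Theory.
Local Open Scope classical_set_scope.
Local Open Scope ring_scope.

(** Write theta for [cyclo] and T for the product Z_1 x ... x Z_r. Structural induction on the
    construction ([principal_extends_automorphisms]) has two nontrivial cases.

    Free product: T lies in one factor, whose canonical map is split injective. So alpha comes from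
    that factor, extends there to some sigma_1, and the universal property yields the free product
    of sigma_1 with the identity. It respects theta by [free_character_eq].

    Extension of G by Z: the flag condition forces alpha(Z) = Z, so on Z x T alpha is triangular,
    (z, x) -> (u z + delta x, beta x), with u a unit of Z_p, beta a flag-preserving automorphism of
    T, and delta additive because theta is trivial on T. By induction beta extends to sigma on G.
    The map (z, g) -> (u z + d g, sigma g) is multiplicative as soon as d (g h) = d g + theta(g) d
    h, so what remains is to extend delta to a crossed homomorphism d of G. This is
    [principal_extends_crossed_homs], a separate induction: crossed homomorphisms are sections of
    the projection from the extension, so they glue over free products, and on an extension their
    values on Z and on G can be prescribed independently. *)

Section Preliminaries.

(** * Continuity on subsets, continuous morphisms, tuple products *)

Lemma within_cts_comp (T U V W : topologicalType) (f : T -> U) (g : V -> W)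
    (A : set T) (B : set U) (a : U -> V) :
  continuous f -> (forall x, A x -> B (f x)) -> {within B, continuous a} ->
  continuous g -> {within A, continuous (fun x => g (a (f x)))}.
Proof.
move=> fC AB /subspace_continuousP aC gC.
apply/subspace_continuousP => x Ax N /gC /(aC _ (AB _ Ax)) /fC.
rewrite -/(nbhs x (f @^-1` [set y | B y -> N (g (a y))])) => fN.
have sub : f @^-1` [set y | B y -> N (g (a y))]
    `<=` [set y | A y -> N (g (a (f y)))] by move=> y /= fyN Ay; exact/fyN/AB.
exact: filterS sub fN.
Qed.

Lemma cont_morphism_comp (G H K : topGroupType) (f : G -> H) (g : H -> K) :
  cont_morphism f -> cont_morphism g -> cont_morphism (g \o f).
Proof.
move=> [[f1 fM] fC] [[g1 gM] gC]; split; last exact: cts_comp fC gC.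
by split; [rewrite /= f1 g1 | move=> x y /=; rewrite fM gM].
Qed.

Lemma cont_morphism_id (G : topGroupType) : cont_morphism (@id G).
Proof. by split; [|move=> x; exact: cvg_id]. Qed.

Lemma cont_morphism_one (G H : topGroupType) :
  cont_morphism (fun _ : G => 1%g : H).
Proof.
by split; [split=> // x y; rewrite mulg1|move=> x; exact: cvg_cst].
Qed.

Lemma tuple_product_image (G H : groupType) (f : G -> H) (A : seq (set G)) :
  monoid.monoid_morphism f ->
  tuple_product (image_tuple f A) = f @` tuple_product A.
Proof.
move=> [f1 fM]; elim: A => [|Z A IHA] /=.
  by apply/seteqP; split=> [x ->|x [_ -> <-]] //=; exists 1%g.
rewrite IHA; apply/seteqP; split=> [x [_ [a Za <-] [_ [b Ab <-] <-]]|].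
  by exists (a * b)%g; [exists a => //; exists b|rewrite fM].
move=> x [_ [a Za [b Ab <-]] <-]; rewrite fM.
by exists (f a); [exists a|exists (f b) => //; exists b].
Qed.

(** The added case j = 0 is the bijectivity of [alpha]. For a tuple with the single entry Z, it is
    this case that gives alpha(Z) = Z. *)
Lemma tuple_automorphism_drop (G : topGroupType) (A : seq (set G))
    (alpha : G -> G) :
  tuple_automorphism A alpha -> forall j, (j <= size A)%N ->
  alpha @` tuple_product (drop j A) = tuple_product (drop j A).
Proof.
case=> _ _ [aT _ aS] aV [_|j ltj]; last exact: aV.
rewrite drop0; apply/seteqP; split; last exact: aS.
by move=> _ [y Ty <-]; exact: aT.
Qed.

End Preliminaries.

(** * Finite p-groups as pro-p groups *)

Section DiscretePGroup.
Variables (p : nat) (H : finGroupType) (pH : (p.-group [set: H]%SET)%g).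

(** The proof that [H] is a p-group is a parameter of the type, so that the pro-p structure can be
    attached to it. *)
Definition discrete_pgroup of (p.-group [set: H]%SET)%g : Type := H.
Local Notation D := (discrete_pgroup pH).

HB.instance Definition _ := monoid.Group.copy D H.
HB.instance Definition _ := Topological.copy D (discrete_topology H).

Lemma discrete_pgroup_cts (T : topologicalType) (f : T -> D) :
  (forall x, nbhs x [set y | f y = f x]) -> continuous f.
Proof.
by move=> fC x U /nbhs_singleton Ufx; apply: filterS (fC x) => y /= ->.
Qed.

Lemma discrete_pgroup_nbhs (x : D) : nbhs x [set x].
Proof. exact: (@discrete_set1 (discrete_topology H)). Qed.

Fact discrete_pgroup_mul_cts : continuous (fun x : D * D => (x.1 * x.2)%g).
Proof.
apply: discrete_pgroup_cts => -[x y]; exists ([set x], [set y]).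
  by split; exact: discrete_pgroup_nbhs.
by move=> [a b] /= [-> ->].
Qed.

Fact discrete_pgroup_inv_cts : continuous (fun x : D => (x^-1)%g).
Proof.
apply: discrete_pgroup_cts => x.
have sub : [set x] `<=` [set y : D | (y^-1)%g = (x^-1)%g] by move=> y ->.
exact: filterS sub (@discrete_pgroup_nbhs x).
Qed.

HB.instance Definition _ := isTopGroup.Build D
  discrete_pgroup_mul_cts discrete_pgroup_inv_cts.

Fact discrete_pgroup_compact : compact [set: D].
Proof. exact (@finite_compact D setT (@finite_finset H setT)). Qed.

Fact discrete_pgroup_hausdorff : hausdorff_space D.
Proof. exact: (@discrete_hausdorff (discrete_topology H)). Qed.

Fact discrete_pgroup_disconnected : totally_disconnected [set: D].
Proof.
apply: zero_dimension_totally_disconnected.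
exact: (@discrete_zero_dimension (discrete_topology H)).
Qed.

Fact discrete_pgroup_quotient (K : finGroupType) (f : D -> K) :
  monoid.monoid_morphism f -> continuous (f : D -> discrete_topology K) ->
  set_surj [set: D] [set: K] f -> (p.-group [set: K]%SET)%g.
Proof.
move=> [f1 fM] _ fsurj.
have fM' : {in [set: H]%SET &, {morph (f : H -> K) : x y / (x * y)%g}}.
  by move=> x y _ _; exact: fM.
have -> : [set: K]%SET = (Morphism fM' @* [set: H]%SET)%g.
  apply/setP => k; rewrite finset.in_setT; apply/esym/morphimP.
  by have [//|x _ <-] := fsurj k; exists x; rewrite ?finset.in_setT.
exact: morphim_pgroup.
Qed.

HB.instance Definition _ := isProP.Build p D
  discrete_pgroup_compact discrete_pgroup_hausdorff
  discrete_pgroup_disconnected discrete_pgroup_quotient.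

End DiscretePGroup.

(** * Uniqueness of homomorphisms out of a free pro-p product *)

Section FreeProduct.
Variables (p : nat) (G1 G2 G : proPGroupType p) (i1 : G1 -> G) (i2 : G2 -> G).

Lemma free_hom_eq (K : proPGroupType p) (f g : G -> K) :
  free_proP_product i1 i2 -> cont_morphism f -> cont_morphism g ->
  f \o i1 = g \o i1 -> f \o i2 = g \o i2 -> f = g.
Proof.
move=> [i1c i2c univ] fc gc fg1 fg2.
have [h [_ huniq]] :=
  univ K _ _ (cont_morphism_comp i1c fc) (cont_morphism_comp i2c fc).
have <- : h = f by apply: huniq.
by apply: huniq; split.
Qed.

(* The universal property only sees pro-p targets; [h] lands in its image,    *)
(* which is a p-group because it is a quotient of [G].                        *)
Lemma free_finite_hom_trivial (H : finGroupType) (h : G -> H) :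
  free_proP_product i1 i2 -> monoid.monoid_morphism h ->
  continuous (h : G -> discrete_topology H) ->
  (forall x, h (i1 x) = 1%g) -> (forall x, h (i2 x) = 1%g) ->
  forall x, h x = 1%g.
Proof.
move=> Gfree [h1 hM] hC hi1 hi2.
pose I := [set k | `[< exists x, h x = k >]]%SET.
have IP k : reflect (exists x, h x = k) (k \in I).
  by rewrite inE; exact: asboolP.
have Igroup : group_set I.
  apply/group_setP; split; first by apply/IP; exists 1%g.
  by move=> _ _ /IP[a <-] /IP[b <-]; apply/IP; exists (a * b)%g; rewrite hM.
pose IG := group Igroup.
have hI x : h x \in IG by apply/IP; exists x.
pose f x : subg_of IG := subg IG (h x).
have fE x : sgval (f x) = h x by rewrite subgK.
have fM : monoid.monoid_morphism f.
  split; first by apply: subg_inj; rewrite fE h1.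
  by move=> x y; apply: subg_inj; rewrite fE hM /= !fE.
have fnear x : nbhs x [set y | f y = f x].
  have /hC : nbhs (h x : discrete_topology H) [set h x] by exact: discrete_set1.
  rewrite -/(nbhs x (h @^-1` [set h x])) => N.
  have sub : h @^-1` [set h x] `<=` [set y | f y = f x].
    by move=> y /= yx; apply: subg_inj; rewrite !fE.
  exact: filterS sub N.
have pI : (p.-group [set: subg_of IG]%SET)%g.
  apply: (@proP_quotient p G _ f) => //.
    by move=> x U /nbhs_singleton Ufx; apply: filterS (fnear x) => y /= ->.
  move=> k _; have /IP[x xk] := subgP k; exists x => //.
  by apply: subg_inj; rewrite fE.
have fc : cont_morphism (f : G -> discrete_pgroup pI).
  by split => //; exact: discrete_pgroup_cts.
move=> x; rewrite -fE.
have -> : f x = 1%g; last by [].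
have f1 y : h y = 1%g -> f y = 1%g by move=> hy; apply: subg_inj; rewrite fE hy.
have fcE : (f : G -> discrete_pgroup pI) = fun=> 1%g.
  by apply: (free_hom_eq Gfree fc (cont_morphism_one _ _));
    apply: funext => y; exact: f1.
by rewrite fcE.
Qed.

End FreeProduct.

(** * Characters into Z_p and additive maps of Z_p *)

Section Characters.
Variables (p : nat) (p_pr : prime p).
Local Notation Zp := (padic p_pr).

Definition padic_character (G : topGroupType) (chi : G -> Zp) : Prop :=
  [/\ chi 1%g = 1, {morph chi : x y / (x * y)%g >-> x * y} & continuous chi].

(** The units of Z_p need not form a pro-p group, so the universal property does not apply directly.
    Modulo p^(n+1) the quotient of the two characters is a map to a finite unit group that dies on
    both factors, hence is trivial by [free_finite_hom_trivial]. *)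
Lemma free_character_eq (G1 G2 G : proPGroupType p) (i1 : G1 -> G)
    (i2 : G2 -> G) (chi psi : G -> Zp) :
  free_proP_product i1 i2 -> padic_character chi -> padic_character psi ->
  chi \o i1 = psi \o i1 -> chi \o i2 = psi \o i2 -> chi = psi.
Proof.
move=> Gfree [chi1 chiM chiC] [psi1 psiM psiC] eq1 eq2.
apply: funext => x; apply: padicP => n.
have char_unit (c : G -> Zp) : c 1%g = 1 ->
    {morph c : x y / (x * y)%g >-> x * y} -> forall y, c y n \is a GRing.unit.
  move=> c1 cM y; apply/unitrP; exists (c y^-1%g n).
  have E (a b : G) : (a * b)%g = 1%g -> c a n * c b n = 1.
    by move=> ab; rewrite -[LHS]/((c a * c b) n) -cM ab c1.
  by rewrite !E ?mulVg ?mulgV.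
pose u := fun y => FinRing.unit 'Z_(p ^ n.+1) (char_unit _ chi1 chiM y).
pose v := fun y => FinRing.unit 'Z_(p ^ n.+1) (char_unit _ psi1 psiM y).
have uM : {morph u : y z / (y * z)%g}.
  by move=> y z; apply: val_inj; rewrite /= chiM.
have vM : {morph v : y z / (y * z)%g}.
  by move=> y z; apply: val_inj; rewrite /= psiM.
have u1 : u 1%g = 1%g by apply: val_inj; rewrite /= chi1.
have v1 : v 1%g = 1%g by apply: val_inj; rewrite /= psi1.
have uvC (a b : {unit 'Z_(p ^ n.+1)}) : (a * b = b * a)%g.
  by apply: val_inj; exact: mulrC.
pose h y := (u y * (v y)^-1)%g.
have hM : monoid.monoid_morphism h.
  split; first by rewrite /h u1 v1 mulgV.
  move=> y z; rewrite /h uM vM invMg -!mulgA; congr (_ * _)%g.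
  by rewrite [RHS]uvC mulgA.
have hC : continuous (h : G -> discrete_topology {unit 'Z_(p ^ n.+1)}).
  move=> y U /nbhs_singleton Uh.
  have Ncy : nbhs y (chi @^-1` [set z | z n = chi y n])
    by apply: chiC; exists n.
  have Npy : nbhs y (psi @^-1` [set z | z n = psi y n])
    by apply: psiC; exists n.
  apply: filterS (filterI Ncy Npy) => z [/= zc zp].
  suff -> : h z = h y by [].
  by rewrite /h; congr (_ * _^-1)%g; apply: val_inj.
have h_ker y : chi y = psi y -> h y = 1%g.
  move=> cp; apply/eqP; rewrite -eq_mulgV1; apply/eqP.
  by apply: val_inj; rewrite /= cp.
have hx : h x = 1%g.
  apply: (free_finite_hom_trivial Gfree hM hC) => y; apply: h_ker.
    exact: (congr1 (@^~ y) eq1).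
  exact: (congr1 (@^~ y) eq2).
have /eqP : u x == v x by rewrite eq_mulgV1 -/(h x) hx.
by move/(congr1 val).
Qed.

(** Natural numbers k are dense in Z_p, and f(k) = k f(1) by additivity. *)
Lemma padic_additive_mul (f : Zp -> Zp) :
  {morph f : x y / x + y} -> continuous f -> forall z, f z = z * f 1.
Proof.
move=> fD fC z.
have f0 : f 0 = 0 by apply: (addrI (f 0)); rewrite -fD !addr0.
have fN x : f (- x) = - f x.
  by apply: (addrI (f x)); rewrite -fD !subrr.
have fnat k : f k%:R = k%:R * f 1.
  elim: k => [|k IHk]; first by rewrite f0 mul0r.
  by rewrite -natr1 fD IHk mulrDl mul1r.
apply: padicP => n.
have /fC [m fm] : nbhs (f 0) [set y | y n = f 0 n] by exists n.
(* Precision m makes f (z - k) vanish at level n, by continuity at 0; precision n does the same for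
   (z - k) * f 1. *)
pose k : nat := z (maxn m n).
have natE j i : (j%:R : Zp) i = j%:R.
  by elim: j => // j IHj; rewrite -!natr1 -IHj.
have zk : (z - k%:R) (maxn m n) = 0.
  rewrite -[LHS]/(z (maxn m n) - (k%:R : Zp) (maxn m n)) natE.
  by rewrite natr_Zp subrr.
have zk_le i : (i <= maxn m n)%N -> (z - k%:R) i = 0.
  by move=> le_i; exact: (@padic_eq_le _ p_pr _ 0 _ _ le_i).
have fzk : (f z - k%:R * f 1) n = 0.
  rewrite -fnat -fN -fD.
  have := fm (z - k%:R) (zk_le _ (leq_maxl _ _)).
  by rewrite /= f0.
have zfk : ((z - k%:R) * f 1) n = 0.
  by rewrite -[LHS]/((z - k%:R) n * f 1 n) zk_le ?leq_maxr// mul0r.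
apply/eqP; rewrite -subr_eq0; apply/eqP.
have -> : f z n - (z * f 1) n = ((f z - k%:R * f 1) - (z - k%:R) * f 1) n.
  by rewrite -[LHS]/((f z - z * f 1) n) mulrBl opprB addrA subrK.
by rewrite -[LHS]/((f z - k%:R * f 1) n - ((z - k%:R) * f 1) n) fzk zfk subrr.
Qed.

End Characters.

(** * Principal tuples and crossed homomorphisms *)

Section Pairs.
Variables (p : nat) (p_pr : prime p).
Local Notation Zp := (padic p_pr).
Local Notation pair := (cyclotomic_pair p_pr).

Lemma ext_mulE (P : pair) (x y : ext_pair P) :
  (x * y)%g = ((x.1 + cyclo x.2 * y.1, (x.2 * y.2)%g) : ext_group P).
Proof. by []. Qed.

Lemma ext_pair_split (P : pair) (z : Zp) (g : P) :
  ((z, g) : ext_pair P) = (((z, 1%g) : ext_pair P) * ext_incl g)%g.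
Proof. by rewrite ext_mulE /= mulr0 addr0 mul1g. Qed.

Lemma ext_kernel_mul (P : pair) (z w : Zp) (g : P) :
  (((z, 1%g) : ext_pair P) * ((w, g) : ext_pair P))%g
  = ((z + w, g) : ext_group P).
Proof. by rewrite ext_mulE /= cyclo1 mul1r mul1g. Qed.

Lemma cts_ext (T : topologicalType) (P : pair) (a : T -> Zp) (b : T -> P) :
  continuous a -> continuous b -> continuous (fun x => (a x, b x) : ext_pair P).
Proof. exact: cts_pair. Qed.

Lemma ext_fst_continuous (P : pair) :
  continuous (fun x : ext_pair P => x.1 : Zp).
Proof. exact: cts_fst. Qed.

Lemma ext_snd_continuous (P : pair) :
  continuous (fun x : ext_pair P => x.2 : P).
Proof. exact: cts_snd. Qed.

Lemma ext_incl_morphism (P : pair) : cont_morphism (@ext_incl _ _ P).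
Proof.
split; last by apply: cts_ext => x; [exact: cvg_cst|exact: cvg_id].
by split=> // g h; rewrite ext_mulE /= mulr0 addr0.
Qed.

Lemma ext_snd_morphism (P : pair) :
  cont_morphism ((fun x => x.2) : ext_pair P -> P).
Proof. by split; [|exact: ext_snd_continuous]. Qed.

Lemma tuple_product_ext (P : pair) (A : seq (set P)) :
  tuple_product (rcons (image_tuple (@ext_incl _ _ P) A) (@ext_kernel _ _ P))
  = [set x : ext_pair P | tuple_product A x.2].
Proof.
elim: A => [|Z A IHA] /=.
  apply/seteqP; split=> [_ [x x1 [_ -> <-]]|x x1] /=.
    by rewrite mulg1.
  by exists x => //; exists 1%g; rewrite ?mulg1.
rewrite IHA; apply/seteqP; split=> [_ [_ [a Za <-] [y Ay <-]]|].
  by exists a => //; exists y.2.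
move=> [w g] /= [a Za [b Ab <-]].
exists (ext_incl a); first by exists a.
(* Moving an element of Z across a multiplies it by theta(a); the factor theta(a)^-1 compensates. *)
exists ((cyclo a^-1%g * w, b) : ext_group P) => //.
by rewrite ext_mulE /= add0r mulrA -cycloM mulgV cyclo1 mul1r.
Qed.

Lemma tuple_product_ext_drop (P : pair) (A : seq (set P)) j :
  (j <= size A)%N ->
  tuple_product
    (drop j (rcons (image_tuple (@ext_incl _ _ P) A) (@ext_kernel _ _ P)))
  = [set x : ext_pair P | tuple_product (drop j A) x.2].
Proof.
move=> le_j; rewrite drop_rcons ?size_map// -tuple_product_ext.
by rewrite /image_tuple map_drop.
Qed.

(** Triviality of theta persists because the maps of a free product preserve theta and on an
    extension theta factors through the projection, which kills Z. It makes crossed homomorphisms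
    additive on the tuple product. *)
Lemma principal_tuple_product (B : pair -> Prop) (P : pair)
    (c : et_construction B P) (A : seq (set P)) :
  principal_tuple c A ->
  [/\ tuple_product A 1%g, forall x, tuple_product A x -> cyclo x = 1 &
    forall j, tuple_product (drop j A) `<=` tuple_product A].
Proof.
elim: c A =>
  [{}P BP|P1 P2 {}P i1 i2 c1 IH1 c2 IH2 nt1 nt2 Pf|{}P c IH] A.
- by move=> ->; split=> [//|_ ->|[|j] x //]; exact: cyclo1.
- have image_case (Q : pair) (i : Q -> P) A' : cont_morphism i ->
      (forall g, cyclo (i g) = cyclo g) ->
      [/\ tuple_product A' 1%g, forall x, tuple_product A' x -> cyclo x = 1 &
        forall j, tuple_product (drop j A') `<=` tuple_product A'] ->
      [/\ tuple_product (image_tuple i A') 1%g,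
        forall x, tuple_product (image_tuple i A') x -> cyclo x = 1 &
        forall j, tuple_product (drop j (image_tuple i A'))
          `<=` tuple_product (image_tuple i A')].
    move=> [im _] ie [T1 Tc TV]; rewrite tuple_product_image//; split.
    + by exists 1%g => //; case: im.
    + by move=> _ [x Tx <-]; rewrite ie Tc.
    + move=> j; rewrite -map_drop tuple_product_image//.
      by move=> _ [x Vx <-]; exists x => //; exact: TV Vx.
  have [[m1 m2 _] e1 e2] := Pf.
  case=> -[A' A'p <-]; [apply: image_case m1 e1 _|apply: image_case m2 e2 _].
    exact: IH1.
  exact: IH2.
- move=> [A' /IH [T1 Tc TV] <-]; rewrite tuple_product_ext.
  split=> // [x|j]; first exact: Tc.
  (* The tuple has one entry more than A': the entry Z survives for j <= size A', and beyond that
     only the trivial subgroup is left. *)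
  have [le_j|lt_j] := leqP j (size A').
    by rewrite tuple_product_ext_drop// => x /=; exact: TV.
  by rewrite drop_oversize ?size_rcons ?size_map// => _ ->.
Qed.

Lemma free_proP_product_sym (G1 G2 G : proPGroupType p) (i1 : G1 -> G)
    (i2 : G2 -> G) : free_proP_product i1 i2 -> free_proP_product i2 i1.
Proof.
move=> [m1 m2 univ]; split=> // K f2 f1 f2c f1c.
have [f [[fc fi1 fi2] funiq]] := univ K f1 f2 f1c f2c.
by exists f; split=> // g [gc gi2 gi1]; exact: funiq.
Qed.

Lemma free_pair_product_sym (P1 P2 P : pair) (i1 : P1 -> P) (i2 : P2 -> P) :
  free_pair_product i1 i2 -> free_pair_product i2 i1.
Proof. by case=> /free_proP_product_sym Pf e1 e2; split. Qed.

Lemma free_hom_exists (G1 G2 G K : proPGroupType p) (i1 : G1 -> G)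
    (i2 : G2 -> G) (f1 : G1 -> K) (f2 : G2 -> K) :
  free_proP_product i1 i2 -> cont_morphism f1 -> cont_morphism f2 ->
  exists f : G -> K, [/\ cont_morphism f, forall x, f (i1 x) = f1 x &
    forall x, f (i2 x) = f2 x].
Proof.
move=> [_ _ univ] f1c f2c; have [f [[fc fi1 fi2] _]] := univ K f1 f2 f1c f2c.
exists f; split=> // x; first by rewrite -fi1.
by rewrite -fi2.
Qed.

Definition crossed_hom (P : pair) (d : P -> Zp) : Prop :=
  continuous d /\ forall g h, d (g * h)%g = d g + cyclo g * d h.

Lemma crossed_hom1 (P : pair) (d : P -> Zp) : crossed_hom d -> d 1%g = 0.
Proof.
move=> [_ dM]; apply: (addrI (d 1%g)).
by rewrite addr0 -{3}(mulg1 1%g) dM cyclo1 mul1r.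
Qed.

(* Crossed homomorphisms are the sections of [ext_pair P -> P], so they can   *)
(* be glued by the universal property of the free product.                    *)
Lemma crossed_hom_free (P1 P2 P : pair) (i1 : P1 -> P) (i2 : P2 -> P)
    (d1 : P1 -> Zp) :
  free_pair_product i1 i2 -> crossed_hom d1 ->
  exists d : P -> Zp, crossed_hom d /\ forall x, d (i1 x) = d1 x.
Proof.
move=> [Pf e1 e2] d1c; have [m1 m2 _] := Pf.
have f1c : cont_morphism (fun x => (d1 x, i1 x) : ext_pair P).
  case: (m1) (d1c) => -[i11 i1M] i1C [d1C d1M]; split; last exact: cts_ext.
  split; first by rewrite crossed_hom1// i11.
  by move=> x y; rewrite ext_mulE /= d1M i1M e1.
have f2c : cont_morphism (@ext_incl _ _ P \o i2).
  exact: cont_morphism_comp m2 (ext_incl_morphism P).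
have [f [fc fi1 fi2]] := free_hom_exists Pf f1c f2c.
have f_snd x : (f x).2 = x.
  have sc := cont_morphism_comp fc (ext_snd_morphism P).
  suff /(congr1 (@^~ x)) : ((fun y => y.2) : ext_pair P -> P) \o f = id by [].
  apply: (free_hom_eq Pf sc (cont_morphism_id P)).
    by apply: funext => y; rewrite /= fi1.
  by apply: funext => y; rewrite /= fi2.
exists (fun x => (f x).1); split; last by move=> x; rewrite fi1.
split; first exact: cts_comp (fc.2) (@ext_fst_continuous P).
by move=> g h; rewrite fc.1.2 ext_mulE /= f_snd.
Qed.

(** Both (z, g) -> z and the inflation of d are crossed homomorphisms, so the value c at the
    generator of Z can be chosen freely. *)
Lemma crossed_hom_ext (P : pair) (d : P -> Zp) (c : Zp) :
  crossed_hom d -> crossed_hom (fun x : ext_pair P => x.1 * c + d x.2).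
Proof.
move=> [dC dM]; split.
  apply: cts_op2 (@padic_add_continuous p p_pr).
    apply: cts_op2 (@ext_fst_continuous P) _ (@padic_mul_continuous p p_pr).
    by move=> x; exact: cvg_cst.
  exact: cts_comp (@ext_snd_continuous P) dC.
move=> [z g] [w h]; rewrite ext_mulE /= -[cyclo _]/(cyclo g) dM.
by rewrite mulrDl mulrDr mulrA addrACA.
Qed.

Lemma ext_padic_continuous (P : pair) :
  continuous (fun z : Zp => (z, 1%g) : ext_pair P).
Proof.
by apply: cts_ext => x; [exact: cvg_id|exact: (@cst_continuous Zp P)].
Qed.

(** If theta is trivial on a subgroup T, this is surjectivity of restriction from crossed
    homomorphisms of P to continuous homomorphisms from T to Z_p. *)
Definition extends_crossed_homs (P : pair) (T : set P) : Prop :=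
  forall delta : P -> Zp, {within T, continuous delta} ->
  {in T &, {morph delta : x y / (x * y)%g >-> x + y}} ->
  exists d : P -> Zp, crossed_hom d /\ forall x, T x -> d x = delta x.

Lemma extends_crossed_homs_free (P1 P2 P : pair) (i1 : P1 -> P) (i2 : P2 -> P)
    (T : set P1) :
  free_pair_product i1 i2 -> extends_crossed_homs T ->
  extends_crossed_homs (i1 @` T).
Proof.
move=> Pf Text delta dC dM; have [[m1 _ _] _ _] := Pf.
have [||d1 [d1c d1E]] := Text (delta \o i1).
- apply: (within_cts_comp (g := id) m1.2 _ dC); last by move=> x; exact: cvg_id.
  by move=> x Tx; exists x.
- move=> x y /set_mem Tx /set_mem Ty; rewrite /= m1.1.2.
  by rewrite dM// inE; [exists x|exists y].
have [d [dc dE]] := crossed_hom_free Pf d1c.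
by exists d; split=> // _ [x Tx <-]; rewrite dE d1E.
Qed.

Lemma principal_extends_crossed_homs (B : pair -> Prop) (P : pair)
    (c : et_construction B P) (A : seq (set P)) :
  principal_tuple c A -> extends_crossed_homs (tuple_product A).
Proof.
elim: c A =>
  [{}P BP|P1 P2 {}P i1 i2 c1 IH1 c2 IH2 nt1 nt2 Pf|{}P c IH] A.
- move=> -> delta _ dM; exists (fun=> 0); split.
    by split=> [x|g h]; [exact: cvg_cst|rewrite mulr0 addr0].
  move=> _ ->; apply: (addrI (delta 1%g)).
  by rewrite addr0 -dM ?mulg1// inE.
- have [[m1 m2 _] _ _] := Pf; case=> -[A' A'p <-].
    rewrite tuple_product_image; last by case: m1.
    exact: extends_crossed_homs_free Pf (IH1 _ A'p).
  rewrite tuple_product_image; last by case: m2.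
  exact: extends_crossed_homs_free (free_pair_product_sym Pf) (IH2 _ A'p).
- move=> [A' A'p <-]; rewrite tuple_product_ext => delta dC dM.
  have [T1 Tc _] := principal_tuple_product A'p.
  have [||d [dc dE]] := IH A' A'p (delta \o @ext_incl _ _ P).
  + apply: (within_cts_comp (g := id) (ext_incl_morphism P).2 _ dC) => //.
    by move=> x; exact: cvg_id.
  + move=> x y /set_mem Tx /set_mem Ty; rewrite /= (ext_incl_morphism P).1.2.
    by rewrite dM// inE.
  have zM z w : delta ((z + w, 1%g) : ext_group P)
      = delta ((z, 1%g) : ext_group P) + delta ((w, 1%g) : ext_group P).
    by rewrite -dM ?inE//= ext_kernel_mul.
  have zC : continuous (fun z => delta ((z, 1%g) : ext_group P)).
    apply/continuous_subspace_setT.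
    apply: (within_cts_comp (g := id) (@ext_padic_continuous P) _ dC) => //.
    by move=> x; exact: cvg_id.
  have zE := padic_additive_mul zM zC.
  (* By [zE], [delta] restricted to Z is multiplication by its value at the generator. *)
  pose k := delta ((1, 1%g) : ext_group P).
  exists (fun x : ext_pair P => x.1 * k + d x.2).
  split; first exact: crossed_hom_ext.
  move=> [z g] /= Tg; rewrite dE//= -zE -dM ?inE//.
  by rewrite -ext_pair_split.
Qed.
End Pairs.

(** * Extension of automorphisms *)

Section Automorphisms.
Variables (p : nat) (p_pr : prime p).
Local Notation Zp := (padic p_pr).
Local Notation pair := (cyclotomic_pair p_pr).

Lemma pair_morphism_character (P Q : pair) (f : P -> Q) :
  cont_morphism f -> padic_character (fun x => cyclo (f x)).
Proof.
move=> [[f1 fM] fC]; split; first by rewrite f1 cyclo1.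
  by move=> x y; rewrite fM cycloM.
exact: cts_comp fC (@cyclo_continuous _ _ Q).
Qed.

(** The inverse is carried as a morphism in its own right, because on a free product it too is built
    by the universal property. *)
Definition inverse_automorphisms (P : pair) (sigma tau : P -> P) : Prop :=
  [/\ pair_morphism sigma, pair_morphism tau,
      cancel sigma tau & cancel tau sigma].

Lemma inverse_automorphismsP (P : pair) (sigma tau : P -> P) :
  pair_morphism sigma -> continuous tau -> cancel sigma tau ->
  cancel tau sigma -> inverse_automorphisms sigma tau.
Proof.
move=> sm tC stK tsK; have [[[s1 sM] _] s_cyclo] := sm.
split=> //; split; last by move=> g; rewrite -s_cyclo tsK.
split=> //; split; first by rewrite -s1 stK.
by move=> x y; rewrite -{1}(tsK x) -{1}(tsK y) -sM stK.
Qed.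

Definition extends_automorphisms (P : pair) (A : seq (set P)) : Prop :=
  forall alpha : P -> P, tuple_automorphism A alpha ->
  exists sigma tau : P -> P, inverse_automorphisms sigma tau /\
    forall x, tuple_product A x -> sigma x = alpha x.

(** Extend [sigma1] and [tau1] by the identity of the other factor. Both composites agree with the
    identity on the two factors, and so do the characters theta o sigma and theta with each
    other. *)
Lemma inverse_automorphisms_free (P1 P2 P : pair) (i1 : P1 -> P)
    (i2 : P2 -> P) (sigma1 tau1 : P1 -> P1) :
  free_pair_product i1 i2 -> inverse_automorphisms sigma1 tau1 ->
  exists sigma tau : P -> P, inverse_automorphisms sigma tau /\
    forall x, sigma (i1 x) = i1 (sigma1 x).
Proof.
move=> [Pf e1 e2] [[s1m s1c] [t1m _] stK tsK].
have [m1 m2 _] := Pf.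
have [sigma [sm si1 si2]] := free_hom_exists Pf (cont_morphism_comp s1m m1) m2.
have [tau [tm ti1 ti2]] := free_hom_exists Pf (cont_morphism_comp t1m m1) m2.
have idP (f : P -> P) : cont_morphism f -> (forall x, f (i1 x) = i1 x) ->
    (forall x, f (i2 x) = i2 x) -> forall x, f x = x.
  move=> fm fi1 fi2 x; suff -> : f = id by [].
  apply: (free_hom_eq Pf fm (cont_morphism_id P)).
    by apply: funext => y; exact: fi1.
  by apply: funext => y; exact: fi2.
have s_cyclo x : cyclo (sigma x) = cyclo x.
  apply: (congr1 (@^~ x) (free_character_eq Pf (pair_morphism_character sm)
    (pair_morphism_character (cont_morphism_id P)) _ _)).
    by apply: funext => y; rewrite /= si1 /= !e1.
  by apply: funext => y; rewrite /= si2.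
exists sigma, tau; split; last exact: si1.
apply: inverse_automorphismsP => //; first exact: tm.2.
- apply: (idP _ (cont_morphism_comp sm tm)) => x /=.
    by rewrite si1 /= ti1 /= stK.
  by rewrite si2 ti2.
- apply: (idP _ (cont_morphism_comp tm sm)) => x /=.
    by rewrite ti1 /= si1 /= tsK.
  by rewrite ti2 si2.
Qed.

(** Killing the second factor gives a left inverse of [i1], through which a map preserving part of
    the image of [i1] is carried back to [P1]. *)
Lemma free_retraction (P1 P2 P : pair) (i1 : P1 -> P) (i2 : P2 -> P) :
  free_pair_product i1 i2 ->
  exists r : P -> P1, cont_morphism r /\ cancel i1 r.
Proof.
move=> [Pf _ _].
have [r [rm ri1 _]] := free_hom_exists Pf (cont_morphism_id P1)
  (cont_morphism_one P2 P1).
by exists r.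
Qed.

Lemma extends_automorphisms_free (P1 P2 P : pair) (i1 : P1 -> P) (i2 : P2 -> P)
    (A : seq (set P1)) :
  free_pair_product i1 i2 -> extends_automorphisms A ->
  extends_automorphisms (image_tuple i1 A).
Proof.
move=> Pf Aext alpha alpha_auto.
have [r [rm i1K]] := free_retraction Pf; have [[m1 _ _] _ _] := Pf.
have dropE j : tuple_product (drop j (image_tuple i1 A))
    = i1 @` tuple_product (drop j A).
  by rewrite -map_drop tuple_product_image//; case: m1.
have alphaV := tuple_automorphism_drop alpha_auto.
have [] := alpha_auto; rewrite tuple_product_image; last by case: m1.
move=> aC aM [aT aI _] _.
pose beta x := r (alpha (i1 x)).
have betaE x : tuple_product A x -> i1 (beta x) = alpha (i1 x).
  move=> Tx; have [|y Ty yE] := aT (i1 x); first by exists x.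
  by rewrite /beta -yE i1K.
have dropT j x : (j <= size A)%N -> tuple_product (drop j A) x ->
    (i1 @` tuple_product (drop j A)) (alpha (i1 x)).
  by move=> le_j Vx; rewrite -dropE -alphaV ?size_map//; exists (i1 x) => //;
    rewrite dropE; exists x.
have betaV j : (j <= size A)%N ->
    beta @` tuple_product (drop j A) = tuple_product (drop j A).
  move=> le_j; apply/seteqP; split=> [_ [x Vx <-]|y Vy].
    by have [y Vy yE] := dropT _ _ le_j Vx; rewrite /beta -yE i1K.
  have := alphaV j; rewrite size_map => /(_ le_j); rewrite dropE => aV.
  have : (i1 @` tuple_product (drop j A)) (i1 y) by exists y.
  rewrite -{1}aV => -[_ [x Vx <-] xE]; exists x => //.
  by rewrite /beta xE i1K.
have beta_auto : tuple_automorphism A beta.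
  split.
  - apply: (within_cts_comp m1.2 _ aC rm.2) => x Tx; by exists x.
  - move=> x y /set_mem Tx /set_mem Ty; rewrite /beta m1.1.2 aM ?rm.1.2//.
      by rewrite inE; exists x.
    by rewrite inE; exists y.
  - have := betaV 0%N (leq0n _); rewrite drop0 => bT; split.
    + by move=> x Tx; rewrite -bT; exists x.
    + move=> x y /set_mem Tx /set_mem Ty bxy.
      apply: (can_inj i1K); apply: aI; rewrite ?inE; [by exists x|by exists y|].
      by rewrite -!betaE ?bxy.
    + by move=> x Tx; rewrite bT.
  - by move=> j /andP[_ le_j]; exact: betaV.
have [sigma1 [tau1 [st1 s1E]]] := Aext _ beta_auto.
have [sigma [tau [st sE]]] := inverse_automorphisms_free Pf st1.
by exists sigma, tau; split=> // _ [x Tx <-]; rewrite sE s1E// betaE.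
Qed.

(** Multiplicativity holds because the first coordinate is a crossed homomorphism, by
    [crossed_hom_ext], and theta o sigma = theta. The inverse is found by solving the triangular
    system. *)
Lemma inverse_automorphisms_ext (P : pair) (sigma tau : P -> P) (d : P -> Zp)
    (u v : Zp) :
  inverse_automorphisms sigma tau -> crossed_hom d -> u * v = 1 ->
  inverse_automorphisms
    (fun x : ext_pair P => (x.1 * u + d x.2, sigma x.2) : ext_pair P)
    (fun x : ext_pair P => ((x.1 - d (tau x.2)) * v, tau x.2) : ext_pair P).
Proof.
move=> [sm tm stK tsK] dc uv; have [[[s1 sM] sC] s_cyclo] := sm.
have [dC dM] := crossed_hom_ext u dc.
have padic_cst (T : topologicalType) (z : Zp) : continuous (fun _ : T => z).
  by move=> x; exact: cvg_cst.
apply: inverse_automorphismsP.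
- split; last by move=> x; rewrite -[LHS]/(cyclo (sigma x.2)) s_cyclo.
  split; last by apply: cts_ext => //;
    exact: cts_comp (@ext_snd_continuous _ _ P) sC.
  split; first by rewrite mul0r add0r (crossed_hom1 dc) s1.
  by move=> x y; rewrite dM sM [RHS]ext_mulE /= s_cyclo.
- have tauC : continuous (fun x : ext_pair P => tau x.2).
    exact: cts_comp (@ext_snd_continuous _ _ P) tm.1.2.
  apply: cts_ext => //.
  apply: cts_op2 (padic_cst _ v) (@padic_mul_continuous p p_pr).
  apply: cts_op2 (@ext_fst_continuous _ _ P) _ (@padic_add_continuous p p_pr).
  apply: cts_comp (@padic_opp_continuous p p_pr).
  exact: cts_comp tauC dc.1.
- by move=> [z g] /=; rewrite stK addrK -mulrA uv mulr1.
- by move=> [z g] /=; rewrite tsK -mulrA (mulrC v) uv mulr1 subrK.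
Qed.

Lemma extends_automorphisms_ext (P : pair) (A : seq (set P)) :
  tuple_product A 1%g -> (forall x, tuple_product A x -> cyclo x = 1) ->
  (forall j, tuple_product (drop j A) `<=` tuple_product A) ->
  extends_crossed_homs (tuple_product A) -> extends_automorphisms A ->
  extends_automorphisms
    (rcons (image_tuple (@ext_incl _ _ P) A) (@ext_kernel _ _ P)).
Proof.
move=> T1 Tc TV Text Aext alpha alpha_auto.
set T := tuple_product A in T1 Tc TV Text *.
have alphaV j (le_j : (j <= size A)%N) :
    alpha @` [set x | tuple_product (drop j A) x.2]
    = [set x | tuple_product (drop j A) x.2].
  rewrite -tuple_product_ext_drop//; apply: tuple_automorphism_drop => //.
  by rewrite size_rcons size_map leqW.
have [] := alpha_auto; rewrite tuple_product_ext -/T => aC aM [aT aI _] _.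
have aMT (x y : ext_pair P) : T x.2 -> T y.2 ->
    alpha (x * y)%g = (alpha x * alpha y)%g.
  by move=> Tx Ty; rewrite aM ?inE.
pose ker z : ext_pair P := ((z, 1%g) : ext_group P).
(* This is the flag condition at j = size A, where only the entry Z remains. *)
have kerV : alpha @` @ext_kernel _ _ P = @ext_kernel _ _ P.
  by have := alphaV _ (leqnn _); rewrite drop_size.
have aker z : (alpha (ker z)).2 = 1%g.
  by rewrite -[_ = _]/(ext_kernel (alpha (ker z))) -kerV; exists (ker z).
pose a0 z : Zp := (alpha (ker z)).1.
have akerE z : alpha (ker z) = ker (a0 z).
  by rewrite [LHS]surjective_pairing aker.
have aE z x : T x ->
    alpha ((z, x) : ext_group P) = (ker (a0 z) * alpha (ext_incl x))%g.
  by move=> Tx; rewrite [X in alpha X]ext_pair_split aMT// -akerE.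
have a0D : {morph a0 : z w / z + w}.
  move=> z w; rewrite {1}/a0 /ker -ext_kernel_mul -!/(ker _) aMT// !akerE.
  by rewrite ext_kernel_mul.
have a0C : continuous a0.
  apply/continuous_subspace_setT.
  by apply: (within_cts_comp (@ext_padic_continuous _ _ P) _ aC
    (@ext_fst_continuous _ _ P)).
have a0E := padic_additive_mul a0D a0C.
(* The preimage of 1 under alpha on Z is an inverse of the multiplier [a0 1]. *)
have [v uv] : exists v, a0 1 * v = 1.
  have : ext_kernel (ker 1) by [].
  rewrite -kerV => -[[v g] /= g1]; rewrite -[g]/(v, g).2 g1 -/(ker v) akerE.
  by move=> [av]; exists v; rewrite mulrC -a0E.
pose beta x := (alpha (ext_incl x)).2.
pose delta x := (alpha (ext_incl x)).1.
have betaV j : (j <= size A)%N ->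
    beta @` tuple_product (drop j A) = tuple_product (drop j A).
  move=> le_j; apply/seteqP; split=> [_ [x Vx <-]|y Vy].
    suff : [set z | tuple_product (drop j A) z.2] (alpha (ext_incl x)) by [].
    by rewrite -alphaV//; exists (ext_incl x).
  have : [set z | tuple_product (drop j A) z.2] (ext_incl y) by [].
  rewrite -{1}alphaV// => -[[z x] /= Vx]; rewrite (aE _ _ (TV _ _ Vx)) => xE.
  by exists x => //; rewrite -[y]/(ext_incl y).2 -xE ext_mulE /= mul1g.
have beta_auto : tuple_automorphism A beta.
  split.
  - apply: (within_cts_comp (ext_incl_morphism P).2 _ aC
      (@ext_snd_continuous _ _ P)) => //.
  - move=> x y /set_mem Tx /set_mem Ty.
    by rewrite /beta (ext_incl_morphism P).1.2 aMT.
  - have := betaV 0%N (leq0n _); rewrite drop0 => bT; split.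
    + by move=> x Tx; rewrite -bT; exists x.
    + move=> x y /set_mem Tx /set_mem Ty bxy.
      (* This w corrects the Z-coordinate: alpha (w, y) = alpha (0, x), so injectivity of alpha
         gives x = y. *)
      pose w := (delta x - delta y) * v.
      have a0w : a0 w = delta x - delta y.
        by rewrite a0E -mulrA (mulrC v) uv mulr1.
      suff : ((w, y) : ext_group P) = ext_incl x by move=> [].
      apply: aI; rewrite ?inE// aE// a0w ext_mulE /= cyclo1 !mul1r mul1g subrK.
      by rewrite [RHS]surjective_pairing; congr (_, _).
    + by move=> x Tx; rewrite bT.
  - by move=> j /andP[_ le_j]; exact: betaV.
have [sigma [tau [st sE]]] := Aext _ beta_auto.
have [||d [dc dE]] := Text delta.
- apply: (within_cts_comp (ext_incl_morphism P).2 _ aC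
    (@ext_fst_continuous _ _ P)) => //.
- move=> x y /set_mem Tx /set_mem Ty.
  rewrite /delta (ext_incl_morphism P).1.2 aMT// ext_mulE /=.
  (* The twist in the product is theta (beta x), which is 1 because beta x lies in T. *)
  by rewrite Tc ?mul1r//; exact: (aT (ext_incl x)).
exists (fun x : ext_pair P => (x.1 * a0 1 + d x.2, sigma x.2) : ext_pair P).
exists (fun x : ext_pair P => ((x.1 - d (tau x.2)) * v, tau x.2) : ext_pair P).
split; first exact: inverse_automorphisms_ext.
move=> [z x] /= Tx; rewrite aE// ext_mulE /= cyclo1 mul1r mul1g -a0E.
by rewrite dE// sE.
Qed.

Lemma principal_extends_automorphisms (B : pair -> Prop) (P : pair)
    (c : et_construction B P) (A : seq (set P)) :
  principal_tuple c A -> extends_automorphisms A.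
Proof.
elim: c A =>
  [{}P BP|P1 P2 {}P i1 i2 c1 IH1 c2 IH2 nt1 nt2 Pf|{}P c IH] A.
- move=> -> alpha [_ aM _ _]; exists id, id; split.
    split=> //; split=> //; exact: cont_morphism_id.
  move=> _ ->; apply: (mulgI (alpha 1%g)).
  by rewrite -aM ?mulg1// inE.
- case=> -[A' A'p <-].
    exact: extends_automorphisms_free Pf (IH1 _ A'p).
  exact: extends_automorphisms_free (free_pair_product_sym Pf) (IH2 _ A'p).
- move=> [A' A'p <-]; have [T1 Tc TV] := principal_tuple_product A'p.
  apply: extends_automorphisms_ext => //; last exact: IH.
  exact: principal_extends_crossed_homs A'p.
Qed.

End Automorphisms.

Theorem theorem5p1 (p : nat) (p_pr : prime p)
    (B : cyclotomic_pair p_pr -> Prop) (B_nonempty : exists P, B P)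
    (P : cyclotomic_pair p_pr) (c : et_construction B P)
    (A : seq (set P)) (A_principal : principal_tuple c A)
    (alpha : P -> P) (alpha_auto : tuple_automorphism A alpha) :
  exists sigma : P -> P,
    pair_automorphism sigma /\
    (forall x : P, tuple_product A x -> sigma x = alpha x).
Proof.
have [sigma [tau [[sm _ stK tsK] sE]]] :=
  principal_extends_automorphisms A_principal alpha_auto.
by exists sigma; split=> //; split=> //; exists tau.
Qed.
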